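(* Let $k<n$ and let $\rho:\mathbb{Z}_2^{\,k}\to\mathrm{GL}(n,\mathbb{Z})$ be a diagonal faithful integral representation with $-Id\notin\mathrm{Im}(\rho)$. Then there is a Bieberbach group (of dimension $n$) whose integral holonomy representation is $\rho$.
   Context: A representation $\rho:\mathbb{Z}_2^{\,k}\to\mathrm{GL}(n,\mathbb{Z})$ is called diagonal here if every $\rho(g)$ is a diagonal matrix (necessarily with entries $\pm1$). A Bieberbach group of dimension $n$ is a torsion-free, discrete, cocompact subgroup $\Gamma$ of $\mathrm{E}(n)=\mathrm{O}(n)\ltimes\mathbb{R}^n$, the group of rigid motions of $\mathbb{R}^n$ with product $(B,b)(C,c)=(BC,Bc+b)$. Its translation subgroup $\Lambda\cong\mathbb{Z}^n$ is normal of finite index, and $G=\Gamma/\Lambda$ is its holonomy group. The integral holonomy representation of $\Gamma$ is the representation $G\to\mathrm{Aut}(\Lambda)\cong\mathrm{GL}(n,\mathbb{Z})$ given by conjugation in $\Gamma$, i.e. $(B,b)$ acts by $\lambda\mapsto B\lambda$. To say that it is $\rho$ means that, under some identifications $G\cong\mathbb{Z}_2^{\,k}$ and $\Lambda\cong\mathbb{Z}^n$, it coincides with $\rho$. *)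

(* Defs.v *)
From HB Require Import structures.
From mathcomp Require Import all_boot all_order all_algebra.
From mathcomp Require Import generic_quotient.
From mathcomp Require Import all_classical all_reals all_analysis.

Set Implicit Arguments.
Unset Strict Implicit.
Unset Printing Implicit Defensive.

Import Order.TTheory GRing.Theory Num.Theory.
Import numFieldNormedType.Exports.

Local Open Scope classical_set_scope.
Local Open Scope ring_scope.

Section EuclideanGroup.
Variables (R : realType) (n : nat).

Definition orthogonal_mx (B : 'M[R]_n) : bool := B *m B^T == 1%:M.

Record euclidean := Euclidean {
  euclidean_pair :> 'M[R]_n * 'cV[R]_n;
  euclidean_orthogonal : orthogonal_mx euclidean_pair.1 }.

HB.instance Definition _ := [isSub for euclidean_pair].
HB.instance Definition _ := [Choice of euclidean by <:].
HB.instance Definition _ :=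
  Topological.copy euclidean (initial_topology euclidean_pair).

Lemma orthogonal_mx1 : orthogonal_mx 1%:M.
Proof. by rewrite /orthogonal_mx trmx1 mulmx1. Qed.

Lemma orthogonal_mxM (B C : 'M[R]_n) :
  orthogonal_mx B -> orthogonal_mx C -> orthogonal_mx (B *m C).
Proof.
move=> /eqP hB /eqP hC; apply/eqP.
by rewrite trmx_mul mulmxA -(mulmxA B) hC mulmx1.
Qed.

Lemma orthogonal_mxV (B : 'M[R]_n) : orthogonal_mx B -> orthogonal_mx B^T.
Proof. by move=> /eqP hB; apply/eqP; rewrite trmxK; exact: mulmx1C. Qed.

Definition euclidean_one : euclidean :=
  @Euclidean (1%:M, 0) orthogonal_mx1.

Definition euclidean_mul (x y : euclidean) : euclidean :=
  @Euclidean (x.1 *m y.1, x.1 *m y.2 + x.2)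
    (orthogonal_mxM (euclidean_orthogonal x) (euclidean_orthogonal y)).

Definition euclidean_inv (x : euclidean) : euclidean :=
  @Euclidean (x.1^T, - (x.1^T *m x.2))
    (orthogonal_mxV (euclidean_orthogonal x)).

Lemma euclidean_mulA : associative euclidean_mul.
Proof.
move=> x y z; apply: val_inj => /=.
by rewrite mulmxDr !mulmxA addrA.
Qed.

Lemma euclidean_mul1g : left_id euclidean_one euclidean_mul.
Proof. by move=> [[B b] hB]; apply: val_inj; rewrite /= !mul1mx addr0. Qed.

Lemma euclidean_mulg1 : right_id euclidean_one euclidean_mul.
Proof. by move=> [[B b] hB]; apply: val_inj; rewrite /= mulmx1 mulmx0 add0r. Qed.

Lemma euclidean_mulVg : left_inverse euclidean_one euclidean_inv euclidean_mul.
Proof.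
move=> [[B b] /= hB]; apply: val_inj => /=.
by rewrite subrr (mulmx1C (eqP hB)).
Qed.

Lemma euclidean_mulgV : right_inverse euclidean_one euclidean_inv euclidean_mul.
Proof.
move=> [[B b] /= hB]; apply: val_inj => /=.
by rewrite mulmxN mulmxA (eqP hB) mul1mx addNr.
Qed.

HB.instance Definition _ := isGroup.Build euclidean
  euclidean_mulA euclidean_mul1g euclidean_mulg1
  euclidean_mulVg euclidean_mulgV.

End EuclideanGroup.

Section CosetSpace.
Variables (R : realType) (n : nat) (Gamma : groupClosed (euclidean R n)).

Definition coset_rel : rel (euclidean R n) :=
  fun x y => (x^-1 * y)%g \in Gamma.

Lemma coset_rel_equiv : equiv_class_of coset_rel.
Proof.
split=> [x|x y|y x z]; rewrite /coset_rel.
- by rewrite mulVg gpred1.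
- by rewrite -gpredV invgM invgK.
- by move=> xy yz; have := gpredM _ _ xy yz; rewrite -mulgA mulVKg.
Qed.

Canonical coset_equiv := EquivRelPack coset_rel_equiv.

Definition coset_space : topologicalType :=
  quotient_topology {eq_quot coset_equiv}%qT.

End CosetSpace.

Section Bieberbach.
Variables (R : realType) (n : nat) (Gamma : groupClosed (euclidean R n)).

Definition torsion_free : Prop :=
  forall (x : euclidean R n) (m : nat),
    x \in Gamma -> (0 < m)%N -> (x ^+ m = 1)%g -> x = 1%g.

Definition discrete_subgroup : Prop := [set` Gamma] `<=` isolated [set` Gamma].

Definition cocompact : Prop := compact [set: coset_space Gamma].

Definition bieberbach : Prop :=
  [/\ torsion_free, discrete_subgroup & cocompact].

Definition translations : set (euclidean R n) :=
  [set x | x \in Gamma /\ x.1 = 1%:M].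

Definition translation_coset (x : euclidean R n) : set (euclidean R n) :=
  [set (x * l)%g | l in translations].

Definition holonomy_group : set (set (euclidean R n)) :=
  [set translation_coset x | x in [set` Gamma]].

(* [phi] identifies Z_2^k with the quotient group Gamma / Lambda, whose elements
   are cosets multiplied as subsets of E(n); [psi] identifies Z^n with Lambda. *)
Definition integral_holonomy_is (k : nat) (rho : 'rV['Z_2]_k -> 'M[int]_n) :
    Prop :=
  exists (phi : 'rV['Z_2]_k -> set (euclidean R n))
         (psi : 'cV[int]_n -> euclidean R n),
  [/\ set_bij setT holonomy_group phi /\
      (forall a b, phi (a + b) = [set (x * y)%g | x in phi a & y in phi b]),
      set_bij setT translations psi /\
      (forall u v, psi (u + v) = (psi u * psi v)%g)
    & forall a x, phi a x ->
      forall z, (x * psi z * x^-1)%g = psi (rho a *m z)].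

End Bieberbach.

Section DiagonalRepresentations.
Variables (k n : nat) (rho : 'rV['Z_2]_k -> 'M[int]_n).

Definition integral_representation : Prop :=
  (forall a, rho a \in unitmx) /\ (forall a b, rho (a + b) = rho a *m rho b).

Definition diagonal_representation : Prop := forall a, is_diag_mx (rho a).

Definition faithful_representation : Prop := injective rho.

End DiagonalRepresentations.

(* Main.v *)
From HB Require Import structures.
Require Import Defs.
From mathcomp Require Import all_boot all_order all_algebra.
From mathcomp Require Import all_classical all_reals all_analysis.
From mathcomp Require Import generic_quotient.
From mathcomp Require Import ring.

Set Implicit Arguments.
Unset Strict Implicit.
Unset Printing Implicit Defensive.

Import Order.TTheory GRing.Theory Num.Theory.
Import numFieldNormedType.Exports.

Local Open Scope classical_set_scope.
Local Open Scope ring_scope.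

(** Write chi_i : Z_2^k -> {1, -1} for the i-th diagonal entry of rho.  The
    group sought is an extension of Z_2^k by Z^n, and a class in
    H^1(Z_2^k; R^n / Z^n) is a tuple of classes with values in R / Z twisted by
    chi_i; any homomorphism from Z_2^k to (1/2)Z / Z gives such a class, because
    x = - x in (1/2)Z / Z.  Lifting a nonzero a to a motion with linear part
    rho a and translation part b, if some positive power of that motion is 1, this
    forces b_i = 0 for every i with chi_i(a) = 1.  So the group is
    torsion-free as soon as every nonzero a has a coordinate i that is fixed by
    rho a and along which the motion translates by an element of 1/2 + Z.

    The whole proof is the choice of the homomorphisms: on coordinate i take the
    character chi_(i+1), indices being read cyclically modulo n, so that a moves
    coordinate i by 1/2 exactly when chi_(i+1)(a) = -1.  For a nonzero, the
    cyclic sequence of signs chi_0(a), ..., chi_(n-1)(a) is not constantly 1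
    because rho is faithful and not constantly -1 because - Id is not in the
    image.  Hence somewhere on the cycle a 1 is followed by a -1
    ([cyclic_ascent], [sign_ascent]), which is the coordinate needed
    ([fiber_torsion_free]).

    The other properties hold for every choice of homomorphisms.  Linear parts
    are integral and, for a fixed linear part, translation parts form a coset of
    Z^n, so distinct elements are at distance at least 1 for the maximum of the
    differences of entries ([fiber_isolated]).
    The group contains Z^n, so each coset has a representative with bounded
    translation part, and such motions form a compact set because the
    orthogonal group is compact ([compact_euclidean],
    [cocompact_of_translations]).  The elements with linear part rho a are
    exactly one coset of the translations, and conjugation acts by rho a
    ([holonomy_crystal_group]). *)

(** * Sign changes along a cycle *)

(** If v never went from false to true along the cycle, its values would be
    monotone along a closed path, hence constant. *)
Lemma cyclic_ascent (I : finType) (v : pred I) (i j : I) :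
  ~~ v i -> v j -> exists l, ~~ v l && v (next (enum I) l).
Proof.
move=> vi vj; apply/existsP; apply: contraT => /existsPn noasc.
pose e : rel I := fun x y => v y ==> v x.
have e_tr : transitive e.
  by move=> y x z /implyP xy /implyP yz; apply/implyP => /yz/xy.
have : cycle e (enum I).
  apply: sub_cycle (cycle_next (enum_uniq I)) => x _ /eqP <-.
  by rewrite /e; have := noasc x; case: (v x) (v (next _ _)) => [] [].
rewrite cycle_all2rel// => /allrelP/(_ i j); rewrite !mem_enum => /(_ isT isT).
by rewrite /e vj (negbTE vi).
Qed.

(** * Compactness in the group of rigid motions *)

Lemma cvg_mx (T : topologicalType) m n (F : set_system 'M[T]_(m, n))
    (M : 'M[T]_(m, n)) :
  Filter F -> (forall i j, (fun N : 'M[T]_(m, n) => N i j) @ F --> M i j) ->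
  F --> M.
Proof.
move=> FF FM A [P MP PA].
suff FP : \forall N \near F, forall i j, P i j ((N : 'M[T]_(m, n)) i j).
  exact: filterS FP.
apply: filter_forall => i; apply: filter_forall => j.
exact: FM (MP i j).
Qed.

(** Any filter finer than the image of F decides each set A in the same way as F
    decides the preimage of A. *)
Lemma ultra_fmap (T U : Type) (f : T -> U) (F : set_system T) :
  UltraFilter F -> UltraFilter (f @ F).
Proof.
move=> FU; split=> [|G GF FG]; first exact: fmap_proper_filter.
apply/seteqP; split=> // A GA.
have [//|FnA] := in_ultra_setVsetC (f @^-1` A) FU.
have /filter_ex[y []//] : G (A `&` ~` A) by apply: filterI => //; exact: FG.
Qed.

(** Tychonoff's theorem for the finite product of copies of T indexed by the
    entries: an ultrafilter of matrices converges entry by entry. *)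
Lemma compact_mx (T : topologicalType) m n (A : set T) :
  compact A -> compact [set M : 'M[T]_(m, n) | forall i j, A (M i j)].
Proof.
rewrite !compact_ultra => cA F FU FA.
have lim_ i j : {x : T | A x & (fun M : 'M[T]_(m, n) => M i j) @ F --> x}.
  apply: cid2.
  have [|x [Ax Fx]] := cA _ (ultra_fmap (fun M : 'M[T]_(m, n) => M i j) FU).
    change (F [set M : 'M[T]_(m, n) | A (M i j)]).
    by apply: filterS FA => M AM; exact: AM.
  by exists x.
exists (\matrix_(i, j) s2val (lim_ i j)); split=> [i j|].
  by rewrite mxE; case: (lim_ i j).
by apply: cvg_mx => i j; rewrite mxE; case: (lim_ i j).
Qed.

Section EuclideanTopology.
Variables (R : realType) (n : nat).

(** Each row of B is a unit vector. *)
Lemma orthogonal_mx_entry (B : 'M[R]_n) i j : orthogonal_mx B -> `|B i j| <= 1.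
Proof.
move=> /eqP/matrixP/(_ i i); rewrite !mxE eqxx (bigD1 j)//= mxE -expr2 => B1.
rewrite -(ler_sqr (normr_ge0 _) ler01) -normrX ger0_norm ?sqr_ge0// expr1n.
rewrite -[leRHS]B1 lerDl sumr_ge0// => l _.
by rewrite mxE -expr2 sqr_ge0.
Qed.

Lemma closed_orthogonal_mx : closed [set B : 'M[R]_n | orthogonal_mx B].
Proof.
have cE i j : continuous (fun B : 'M[R]_n => (B *m B^T) i j).
  rewrite (_ : (fun _ => _) = (fun B : 'M[R]_n => \sum_l B i l * B j l)).
    apply: continuous_big => [|l _ B]; first exact: add_continuous.
    by apply: continuousM; exact: coord_continuous.
  by apply/funext => B; rewrite mxE; apply: eq_bigr => l _; rewrite mxE.
rewrite (_ : [set B | _] = \bigcap_(ij in [set: 'I_n * 'I_n])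
  ((fun B : 'M[R]_n => (B *m B^T) ij.1 ij.2) @^-1` [set (1%:M : 'M[R]_n) ij.1 ij.2])).
  apply: closed_bigI => ij _; apply: preimage_closed.
    by move=> B _; exact: cE.
  exact: closed_eq.
rewrite eqEsubset; split=> B /=.
  by move=> /eqP BB ij _ /=; rewrite BB.
by move=> BB; apply/eqP/matrixP => i j; exact: (BB (i, j) I).
Qed.

(** The bound on the translation part suffices, since the linear parts range
    over the compact group O(n). *)
Lemma compact_euclidean (r : R) :
  compact [set x : euclidean R n | forall i, `|x.2 i 0| <= r].
Proof.
rewrite compact_ultra => F FU Fr.
have ball_compact (s : R) : compact [set z : R | `|z| <= s].
  rewrite (_ : [set z | _] = [set` `[- s, s]]); first exact: segment_compact.
  by apply/seteqP; split=> z /=; rewrite in_itv/= ler_norml.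
have : compact ([set M : 'M[R]_n | forall i j, `|M i j| <= 1]
   `*` [set M : 'cV[R]_n | forall i j, `|M i j| <= r]).
  by apply: compact_setX; exact: compact_mx (ball_compact _).
rewrite compact_ultra => /(_ (@euclidean_pair R n @ F) (ultra_fmap _ FU)) [].
  change (F [set x : euclidean R n |
    (forall i j, `|x.1 i j| <= 1) /\ (forall i j, `|x.2 i j| <= r)]).
  apply: filterS Fr => x xr; split=> i j; last by rewrite ord1; exact: xr.
  by apply: orthogonal_mx_entry; exact: euclidean_orthogonal.
move=> [B b] [[_ br] FBb].
have BO : orthogonal_mx B.
  apply: (@closed_cvg _ 'M[R]_n F _ (fun x : euclidean R n => x.1)
    (fun B : 'M[R]_n => orthogonal_mx B) closed_orthogonal_mx _ B).
    by apply: nearW => x; exact: euclidean_orthogonal.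
  exact: cvg_comp FBb cvg_fst.
exists (@Euclidean R n (B, b) BO); split=> [i|]; first exact: br.
move=> A [_ [[V oV <-] VBb VA]].
by apply: filterS VA _; apply: FBb; exact: open_nbhs_nbhs.
Qed.

Definition translation (z : 'cV[int]_n) : euclidean R n :=
  @Euclidean R n (1%:M, map_mx intr z) (orthogonal_mx1 R n).

(** Let (B, b) be a motion.  Multiplying it on the right by the translation z
    changes b to b + B z = B (z + B^-1 b), and z can be chosen so that
    z + B^-1 b lies in the unit cube, which B maps into the cube of radius n.
    Thus a compact set of motions meets every coset. *)
Lemma cocompact_of_translations (Gamma : groupClosed (euclidean R n)) :
  (forall z, translation z \in Gamma) -> cocompact Gamma.
Proof.
move=> GammaT; rewrite /cocompact.
pose K := [set x : euclidean R n | forall i, `|x.2 i 0| <= n%:R].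
suff -> : [set: coset_space Gamma] = [set (\pi_(coset_space Gamma)%qT x) | x in K].
  apply: continuous_compact; last exact: compact_euclidean.
  by apply: continuous_subspaceT; exact: pi_continuous.
apply/seteqP; split=> // q _.
pose x : euclidean R n := repr q.
pose w := x.1^T *m x.2.
pose z : 'cV[int]_n := \col_i - Num.floor (w i 0).
have piE : \pi_({eq_quot coset_equiv Gamma})%qT x =
    \pi_({eq_quot coset_equiv Gamma})%qT (x * translation z)%g.
  by apply/eqmodP; rewrite /= /coset_rel mulKg GammaT.
exists (x * translation z)%g; last by rewrite -[RHS]reprK; exact: esym piE.
have xzE : x.1 *m map_mx intr z + x.2 = x.1 *m (map_mx intr z + w).
  by rewrite mulmxDr /w mulmxA (eqP (euclidean_orthogonal x)) mul1mx.
move=> i /=; rewrite xzE mxE (le_trans (ler_norm_sum _ _ _))//.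
rewrite -[n in n%:R]card_ord -sumr_const ler_sum// => j _.
rewrite normrM -[leRHS]mulr1 ler_pM ?orthogonal_mx_entry ?euclidean_orthogonal//.
rewrite !mxE rmorphN/= addrC ger0_norm ?subr_ge0 ?floor_le//.
by rewrite lerBlDr addrC -[1]/(1%:~R) -rmorphD/= ltW// floorD1_gt.
Qed.

(** * Discreteness of separated sets *)

(** The topology of rigid motions is induced by the maximum distance between
    entries, so the hypothesis on x empties the ball of radius 1 around it. *)
Lemma isolated_of_separated (A : set (euclidean R n)) (x : euclidean R n) :
  A x ->
  (forall y, A y -> (forall i j, `|x.1 i j - y.1 i j| < 1) ->
    (forall i, `|x.2 i 0 - y.2 i 0| < 1) -> y = x) ->
  isolated A x.
Proof.
move=> Ax sepx; split; first exact: mem_set.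
exists (@euclidean_pair R n @^-1` ball (euclidean_pair x) 1).
  apply: (@initial_continuous _ _ (@euclidean_pair R n)).
  exact: nbhsx_ballx.
apply/seteqP; split=> [y [[[_ xy1] [_ xy2]] Ay]|y ->].
  by apply: sepx => [//|i j|i]; [exact: xy1|exact: xy2].
by split=> //; exact: ballxx.
Qed.

End EuclideanTopology.

(** * Signs of a diagonal representation *)

Section DiagonalHolonomy.
Variables (R : realType) (k n : nat) (rho : 'rV['Z_2]_k -> 'M[int]_n).
Hypothesis rho_rep : integral_representation rho.
Hypothesis rho_diag : diagonal_representation rho.
Hypothesis rho_faithful : faithful_representation rho.
Hypothesis rho_neg : ~ range rho (- 1%:M).

Local Notation succ := (next (enum 'I_n)).

Lemma rho0 : rho 0 = 1%:M.
Proof.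
have [rhoU rhoD] := rho_rep.
by rewrite -[LHS](mulmxK (rhoU 0)) -rhoD addr0 mulmxV.
Qed.

Lemma Z2row_addK (a : 'rV['Z_2]_k) : a + a = 0.
Proof.
apply/rowP => i; rewrite !mxE; apply: val_inj.
by case: (a 0 i) => [[|[|m]] lt_m2].
Qed.

Lemma rho_diagE a i j : rho a i j = rho a i i *+ (i == j).
Proof. by case: eqVneq => [->//|ij]; rewrite (is_diag_mxP (rho_diag a)). Qed.

Lemma rho_mulE a m (M : 'M[int]_(n, m)) i j :
  (rho a *m M) i j = rho a i i * M i j.
Proof.
rewrite mxE (bigD1 i)//= big1 ?addr0// => l li.
by rewrite rho_diagE eq_sym (negbTE li) mul0r.
Qed.

Lemma signD a b i : rho (a + b) i i = rho a i i * rho b i i.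
Proof. by rewrite rho_rep.2 rho_mulE. Qed.

Lemma sign_cases a i : rho a i i = 1 \/ rho a i i = -1.
Proof.
have /eqP : rho a i i ^+ 2 = 1.
  by rewrite expr2 -signD Z2row_addK rho0 mxE eqxx.
by rewrite sqrf_eq1 => /orP[] /eqP; [left|right].
Qed.

(** Coordinate i is fixed by rho a while the next one is reversed: this
    is the coordinate along which the elements over a will translate by 1/2
    modulo integers. *)
Lemma sign_ascent a : a <> 0 ->
  exists i, rho a i i = 1 /\ rho a (succ i) (succ i) = -1.
Proof.
move=> a0; pose v i := rho a i i == -1.
have [i vi] : exists i, ~~ v i.
  apply: contra_notP rho_neg => /forallNP vT; exists a => //.
  apply/matrixP => i j; rewrite rho_diagE !mxE -mulNrn.
  by have /negP/negPn/eqP -> := vT i.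
have [j vj] : exists j, v j.
  apply: contra_notP a0 => /forallNP vF; apply: rho_faithful.
  apply/matrixP => i' j; rewrite rho_diagE rho0 mxE.
  by case: (sign_cases a i') => [->//|/eqP]; have := vF i'.
have [l /andP[vl vnl]] := cyclic_ascent vi vj.
exists l; split; last exact/eqP.
by case: (sign_cases a l) => // /eqP; rewrite -/(v l) (negbTE vl).
Qed.

(** * The crystallographic group *)

Definition rotation a : 'M[R]_n := map_mx intr (rho a).

Lemma rotation_mulE a m (M : 'M[R]_(n, m)) i j :
  (rotation a *m M) i j = (rho a i i)%:~R * M i j.
Proof.
rewrite mxE (bigD1 i)//= mxE big1 ?addr0// => l li.
by rewrite mxE rho_diagE eq_sym (negbTE li) mul0r.
Qed.

Lemma rotationD a b : rotation (a + b) = rotation a *m rotation b.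
Proof. by rewrite /rotation rho_rep.2 map_mxM. Qed.

Lemma rotation0 : rotation 0 = 1%:M.
Proof. by rewrite /rotation rho0 map_mx1. Qed.

Lemma rotation_inj : injective rotation.
Proof.
move=> a b /matrixP ab; apply: rho_faithful; apply/matrixP => i j.
by have := ab i j; rewrite !mxE => /intr_inj.
Qed.

Lemma tr_rotation a : (rotation a)^T = rotation a.
Proof.
apply/matrixP => i j; rewrite !mxE (rho_diagE a i j) (rho_diagE a j i) eq_sym.
by case: eqP => // ->.
Qed.

Lemma rotation_orthogonal a : orthogonal_mx (rotation a).
Proof. by rewrite /orthogonal_mx tr_rotation -rotationD Z2row_addK rotation0. Qed.

(** Coordinate i carries the character of coordinate i + 1, with values in
    {0, 1/2}. *)
Definition half_shift a : 'cV[R]_n :=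
  \col_i if rho a (succ i) (succ i) == -1 then 2^-1 else 0.

Lemma half_shift0 : half_shift 0 = 0.
Proof. by apply/colP => i; rewrite !mxE rho0 mxE eqxx. Qed.

(** Modulo integers the sign rho a i i acts trivially on {0, 1/2}, so the
    cocycle identity reduces to the fact that half_shift comes from a
    homomorphism. *)
Lemma half_shift_cocycle a b i :
  (rho a i i)%:~R * half_shift b i 0 + half_shift a i 0 - half_shift (a + b) i 0
    \is a Num.int.
Proof.
rewrite !mxE signD.
have N2 : 2^-1 + 2^-1 = 1 :> R by rewrite [RHS]splitr mul1r.
case: (sign_cases a i) => ->; rewrite ?mul1r ?mulN1r.
all: set j := succ i; case: (sign_cases a j) => ->; case: (sign_cases b j) => ->.
all: rewrite /= ?addr0 ?add0r ?oppr0 ?subrr ?addNr ?N2 ?subr0 ?rpred0 ?rpred1 //.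
all: by rewrite -?opprD ?N2 ?rpredN ?addr0 ?add0r ?subrr ?rpred0 ?rpred1.
Qed.

Definition lift_point a : euclidean R n :=
  @Euclidean R n (rotation a, half_shift a) (rotation_orthogonal a).

(** The fiber over a of the projection to Z_2^k.  It comes before the group,
    whose closure properties and holonomy are both read off from the way fibers
    multiply. *)
Definition fiber a : set (euclidean R n) :=
  [set x : euclidean R n | x.1 = rotation a /\
    forall i, x.2 i 0 - half_shift a i 0 \is a Num.int].

Lemma fiber_lift_point a : fiber a (lift_point a).
Proof. by split=> // i; rewrite subrr rpred0. Qed.

Lemma fiberM a b x y : fiber a x -> fiber b y -> fiber (a + b) (x * y)%g.
Proof.
move=> [x1 xZ] [y1 yZ]; split=> [/=|i]; first by rewrite x1 y1 rotationD.
rewrite /= x1 mxE rotation_mulE; set s := half_shift (a + b) i 0.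
rewrite (_ : _ - s = (rho a i i)%:~R * (y.2 i 0 - half_shift b i 0) +
  (x.2 i 0 - half_shift a i 0) +
  ((rho a i i)%:~R * half_shift b i 0 + half_shift a i 0 - s)); last by ring.
by rewrite rpredD ?half_shift_cocycle// rpredD// rpredM// intr_int.
Qed.

Lemma fiberV a x : fiber a x -> fiber a x^-1%g.
Proof.
move=> [x1 xZ]; split=> [/=|i]; first by rewrite x1 tr_rotation.
have := half_shift_cocycle a a i; rewrite Z2row_addK half_shift0.
rewrite [(0 : 'cV_n) i 0]mxE subr0 => aaZ.
rewrite /= x1 tr_rotation mxE rotation_mulE.
rewrite (_ : _ - _ = - ((rho a i i)%:~R * (x.2 i 0 - half_shift a i 0) +
  ((rho a i i)%:~R * half_shift a i 0 + half_shift a i 0))); last by ring.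
by rewrite rpredN rpredD// rpredM// intr_int.
Qed.

Lemma fiber0P x : fiber 0 x <-> exists z, x = translation R z.
Proof.
split=> [[x1 xZ]|[z ->]]; last first.
  by split=> [|i]; rewrite ?rotation0// half_shift0 !mxE subr0 intr_int.
exists (\col_i Num.floor (x.2 i 0)).
apply: val_inj; rewrite /= -rotation0 -x1 [LHS]surjective_pairing; congr pair.
apply/colP => i; rewrite !mxE; apply/esym/eqP; rewrite -intrEfloor.
by have := xZ i; rewrite half_shift0 mxE subr0.
Qed.

Lemma fiber_inj a b x : fiber a x -> fiber b x -> a = b.
Proof. by move=> [xa _] [xb _]; apply: rotation_inj; rewrite -xa -xb. Qed.

(** On a coordinate fixed by rho a the powers of x translate by multiples of
    x_i, so x_i = 0 if x has finite order.  If a is nonzero, some fixed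
    coordinate has x_i in 1/2 + Z, which is absurd; if a = 0, all coordinates
    are fixed and x = 1. *)
Lemma fiber_torsion_free a x m : fiber a x -> (0 < m)%N -> (x ^+ m = 1)%g -> x = 1%g.
Proof.
move=> [x1 xZ] m0 xm1.
have fixed i : rho a i i = 1 -> x.2 i 0 = 0.
  move=> ai; have xE l : (x ^+ l)%g.2 i 0 = x.2 i 0 *+ l.
    elim: l => [|l IHl]; first by rewrite expg0 mulr0n mxE.
    rewrite expgS mulrS addrC -IHl /= mxE x1 rotation_mulE ai mul1r.
    by [].
  have := xE m; rewrite xm1 mxE => /esym/eqP; rewrite mulrn_eq0.
  by rewrite -leqn0 leqNgt m0 => /eqP.
have [a0|/eqP/sign_ascent[i [ai]]] := eqVneq a 0.
  apply: val_inj; rewrite /= [LHS]surjective_pairing x1 a0 rotation0.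
  by congr pair; apply/colP => i; rewrite fixed ?mxE// a0 rho0 mxE eqxx.
move=> ani; have := xZ i; rewrite fixed// mxE ani eqxx sub0r rpredN => half.
have := norm_intr_ge1 half; rewrite invr_neq0// => /(_ isT).
by rewrite ger0_norm ?invr_ge0// leNgt invf_lt1 ?ltr1n.
Qed.

Definition crystal : {pred euclidean R n} := fun x => `[< exists a, fiber a x >].

Lemma crystalP x : reflect (exists a, fiber a x) (x \in crystal).
Proof. exact: asboolP. Qed.

Lemma crystalV : {in crystal, forall x, x^-1%g \in crystal}.
Proof. by move=> x /crystalP[a xa]; apply/crystalP; exists a; exact: fiberV. Qed.

Lemma crystal1 : 1%g \in crystal.
Proof.
apply/crystalP; exists 0; apply/fiber0P; exists 0.
by apply: val_inj; rewrite /= map_mx0.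
Qed.

Lemma crystalM : {in crystal &, forall x y, (x * y)%g \in crystal}.
Proof.
move=> x y /crystalP[a xa] /crystalP[b yb].
by apply/crystalP; exists (a + b); exact: fiberM.
Qed.

Definition crystal_group : groupClosed (euclidean R n) :=
  HB.pack crystal (isInvClosed.Build _ crystal crystalV)
    (isMul1Closed.Build _ crystal crystal1)
    (isMulClosed.Build _ crystal crystalM).

Lemma crystal_groupP x : reflect (exists a, fiber a x) (x \in crystal_group).
Proof. exact: crystalP. Qed.

(** Linear parts are integral, and equal linear parts force the same fiber,
    where translation parts differ by integers. *)
Lemma fiber_isolated a x :
  fiber a x -> isolated [set` crystal_group] x.
Proof.
move=> xa; apply: isolated_of_separated; first by apply/crystal_groupP; exists a.
move=> y /crystal_groupP[b yb] xy1 xy2.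
have int_small (z : R) : z \is a Num.int -> `|z| < 1 -> z = 0.
  move=> zZ; apply: contraTeq => z0.
  by rewrite -leNgt norm_intr_ge1.
have y1 : y.1 = x.1.
  apply/matrixP => i j; apply/esym/subr0_eq/int_small => //.
  by rewrite xa.1 yb.1 !mxE rpredB// intr_int.
have ab : a = b by apply: rotation_inj; rewrite -xa.1 -yb.1 y1.
apply: val_inj; rewrite /= [LHS]surjective_pairing [RHS]surjective_pairing y1.
congr pair; apply/colP => i; apply/esym/subr0_eq/int_small => //.
rewrite -[x.2 i 0](subrK (half_shift a i 0)) -addrA rpredD ?xa.2//.
by rewrite -opprB rpredN {1}ab yb.2.
Qed.

Lemma crystal_group_translation z : translation R z \in crystal_group.
Proof. by apply/crystal_groupP; exists 0; apply/fiber0P; exists z. Qed.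

Lemma bieberbach_crystal_group : bieberbach crystal_group.
Proof.
split.
- by move=> x m /crystal_groupP[a xa]; exact: fiber_torsion_free xa.
- by move=> x /crystal_groupP[a xa]; exact: fiber_isolated xa.
- exact: cocompact_of_translations crystal_group_translation.
Qed.

(** * Holonomy *)

Lemma translationsE : translations crystal_group = range (@translation R n).
Proof.
apply/seteqP; split=> [x [/crystal_groupP[a xa] x1]|x [z _ <-]].
  have a0 : a = 0 by apply: rotation_inj; rewrite -xa.1 rotation0.
  by have /fiber0P[z ->] : fiber 0 x by rewrite -a0.
by split=> //; exact: crystal_group_translation.
Qed.

Lemma translation_coset_fiber a x :
  fiber a x -> translation_coset crystal_group x = fiber a.
Proof.
move=> xa; rewrite /translation_coset translationsE.
apply/seteqP; split=> [_ [_ [z _ <-] <-]|y ya].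
  rewrite -[a]addr0; apply: fiberM => //.
  by apply/fiber0P; exists z.
have /fiber0P[z zE] : fiber 0 (x^-1 * y)%g.
  by rewrite -(Z2row_addK a); apply: fiberM => //; exact: fiberV.
by exists (translation R z); [exists z | rewrite -zE mulVKg].
Qed.

Lemma translation_conj a x z :
  fiber a x -> (x * translation R z * x^-1)%g = translation R (rho a *m z).
Proof.
move=> [x1 _]; apply: val_inj; rewrite /= mulmx1 (eqP (euclidean_orthogonal x)).
congr pair; rewrite mulmxN mulmxA (eqP (euclidean_orthogonal x)) mul1mx.
by rewrite addrC addrK x1 map_mxM.
Qed.

Lemma holonomy_crystal_group : integral_holonomy_is crystal_group rho.
Proof.
exists fiber, (@translation R n); split; last by move=> a x xa z; exact: translation_conj.
  split=> [|a b].
    split=> [a _|a b _ _ ab|_ [x /crystal_groupP[a xa] <-]].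
    - exists (lift_point a); last exact: translation_coset_fiber (fiber_lift_point a).
      by apply/crystal_groupP; exists a; exact: fiber_lift_point.
    - by apply: (@fiber_inj _ _ (lift_point a)); rewrite -?ab; exact: fiber_lift_point.
    - by exists a => //; rewrite (translation_coset_fiber xa).
  apply/seteqP; split=> [x xab|_ [x xa [y yb <-]]]; last exact: fiberM.
  exists (lift_point a); first exact: fiber_lift_point.
  exists ((lift_point a)^-1 * x)%g; last by rewrite mulVKg.
  have -> : b = a + (a + b) by rewrite addrA Z2row_addK add0r.
  by apply: fiberM => //; apply: fiberV; exact: fiber_lift_point.
split=> [|u v].
  rewrite translationsE; split=> [z _|u v _ _ uv|//]; first by exists z.
  apply/colP => i; apply: (@intr_inj R).
  have /colP/(_ i) := congr1 (fun x : euclidean R n => x.2) uv.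
  by rewrite !mxE.
apply: val_inj; rewrite /= !mul1mx map_mxD addrC.
by [].
Qed.

End DiagonalHolonomy.

(** * Existence of the Bieberbach group *)

Theorem theorem5p1 (R : realType) (k n : nat)
    (rho : 'rV['Z_2]_k -> 'M[int]_n) :
  (k < n)%N ->
  integral_representation rho -> diagonal_representation rho ->
  faithful_representation rho ->
  ~ range rho (- 1%:M) ->
  exists Gamma : groupClosed (euclidean R n),
    bieberbach Gamma /\ integral_holonomy_is Gamma rho.
Proof.
move=> _ rep diag faith neg.
exists (crystal_group R rep diag); split.
  exact: bieberbach_crystal_group.
exact: holonomy_crystal_group.
Qed.
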